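(* Let $\tau>2$, $A>0$ and $\bar d>0$ be constants, and put $$b=0.1\left(\frac{\tau-2}{8A}\right)^{\frac{1}{2(\tau-2)}}.$$ There is $n_0$ such that for every $n\ge n_0$ the following holds. If $G$ is an $n$-vertex graph with degree sequence $(d_i)_{i\in[n]}$ and average degree $\bar d$, satisfying $$\frac1n\,\bigl|\{i\in[n]: d_i\ge k\}\bigr|\ \le\ A\,\bar d^{\,\tau-1}k^{1-\tau}\qquad\text{for all integers }k\ge 1,$$ then $$q^*(G)\ \ge\ b\,\bar d^{-1/2}.$$
   Context: Graphs are finite and simple; $[n]=\{1,\dots,n\}$. $d_v$ is the degree of $v$, and for a vertex set $S$, $\mathrm{vol}(S)=\sum_{v\in S}d_v$ and $e(S)$ is the number of edges with both endpoints in $S$. For a graph $G$ with $m\ge 1$ edges and a partition $\mathcal P$ of $V(G)$, the modularity score is $q_{\mathcal P}(G)=\sum_{S\in\mathcal P}\left(\frac{e(S)}{m}-\left(\frac{\mathrm{vol}(S)}{2m}\right)^2\right)$, and the modularity of $G$ is $q^*(G)=\max_{\mathcal P}q_{\mathcal P}(G)$ over all partitions $\mathcal P$ of $V(G)$. *)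

(* Defs.v *)
From HB Require Import structures.
From mathcomp Require Import all_boot all_order all_algebra.
From mathcomp Require Import reals.

Set Implicit Arguments.
Unset Strict Implicit.
Unset Printing Implicit Defensive.
Import Order.TTheory GRing.Theory Num.Theory.
Local Open Scope ring_scope.

Definition simple_graph (V : finType) (adj : rel V) : Prop :=
  symmetric adj /\ irreflexive adj.

Definition degree (V : finType) (adj : rel V) (v : V) : nat :=
  #|[set w | adj v w]|.

(* Edges are unordered pairs of vertices, so each edge is counted once. *)
Definition edge_set (V : finType) (adj : rel V) : {set {set V}} :=
  [set [set x; y] | x in V, y in V & adj x y].

Definition edges_within (V : finType) (adj : rel V) (S : {set V}) : nat :=
  #|[set f in edge_set adj | f \subset S]|.

Definition vol (V : finType) (adj : rel V) (S : {set V}) : nat :=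
  (\sum_(v in S) degree adj v)%N.

Definition average_degree (R : realType) (V : finType) (adj : rel V) : R :=
  (\sum_(v : V) degree adj v)%N%:R / #|V|%:R.

Definition modularity_score (R : realType) (V : finType) (adj : rel V)
    (P : {set {set V}}) : R :=
  let m : R := #|edge_set adj|%:R in
  \sum_(S in P) ((edges_within adj S)%:R / m
                 - ((vol adj S)%:R / (2 * m)) ^+ 2).

Definition singletons (V : finType) : {set {set V}} :=
  [set [set v] | v : V].

(* The partition into singletons only seeds the iterated maximum; as it is
   itself a partition, the value is the maximum over all partitions, see
   [modularity_attained] and [modularity_upper_bound]. *)
Definition modularity (R : realType) (V : finType) (adj : rel V) : R :=
  \big[Num.max/modularity_score R adj (singletons V)]_
    (P : {set {set V}} | partition P [set: V]) modularity_score R adj P.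

Lemma singletons_partition (V : finType) : partition (singletons V) [set: V].
Proof.
apply/and3P; split.
- apply/eqP/setP=> x; rewrite inE; apply/bigcupP.
  by exists [set x]; rewrite ?set11 //; apply: imset_f.
- apply/trivIsetP=> _ _ /imsetP[x _ ->] /imsetP[y _ ->] nxy.
  by rewrite disjoints1 inE; apply: contra nxy => /eqP->.
- by apply/imsetP=> -[x _ /setP/(_ x)]; rewrite !inE eqxx.
Qed.

Lemma modularity_attained (R : realType) (V : finType) (adj : rel V) :
  exists2 P : {set {set V}}, partition P [set: V] &
    modularity R adj = modularity_score R adj P.
Proof.
rewrite /modularity; elim/big_ind: _ => [|x y [P HP ->] [Q HQ ->]|P HP].
- by exists (singletons V) => //; apply: singletons_partition.
- by rewrite /Num.max; case: ifP => _; [exists Q | exists P].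
- by exists P.
Qed.

Lemma modularity_upper_bound (R : realType) (V : finType) (adj : rel V)
    (P : {set {set V}}) :
  partition P [set: V] -> modularity_score R adj P <= modularity R adj.
Proof. by move=> HP; rewrite /modularity; apply: le_bigmax_cond. Qed.

(* Main.v *)
(* For a bipartition with signs X and degree sum W = 2m, the modularity score is
   (sum over ordered adjacent pairs of X_u X_v) / (2 W)
     - (sum_v d_v X_v)^2 / (2 W^2).
   Start from uniform signs, and let each vertex of degree at most D = 16 x
   switch, with probability 1/2, to the majority sign of its neighbours.  By
   Harris' inequality the correlations between two majorities are nonnegative,
   so the first sum has mean at least 1/2 sum_low E|S_v|, where S_v is the sum
   of the signs at the neighbours of v, and E|S_v| >= 9/16 sqrt d_v.
   The new sign of v depends oddly on the signs in a set which is the closed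
   neighbourhood of v for low v and {v} otherwise; two vertices with disjoint
   such sets are uncorrelated, whence the second sum has mean square at most
   (1 + D)^2 sum_v d_v^2 <= (1 + D)^2 W max_v d_v = o(W^2), the tail condition
   forcing the maximal degree to be o(n).
   With x = (8 A / (tau - 2))^(1 / (tau - 2)) dbar the tail condition gives
   sum_v (d_v - x)_+ <= W / 8, hence sum_low sqrt d_v >= 13/16 W / sqrt x, and
   the claimed bound is 1 / (10 sqrt x) < 117/1024 / sqrt x. *)
Require Import Defs.
From mathcomp Require Import all_boot all_order all_algebra.
From mathcomp Require Import reals exp.
From mathcomp Require Import ring lra.
Import Order.TTheory GRing.Theory Num.Theory.
Local Open Scope ring_scope.

Set Implicit Arguments.
Unset Strict Implicit.
Unset Printing Implicit Defensive.

(** * Uniform random signs: flips, Harris' inequality and Khinchine's inequality *)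

Section Signs.
Variables (R : realType) (V : finType).
Implicit Types (A B D : {set V}) (f g : {set V} -> R).

Lemma sum_set_const (c : R) : \sum_(A : {set V}) c = #|{set V}|%:R * c.
Proof. by rewrite sumr_const mulr_natl; congr (_ *+ _); apply: eq_card. Qed.

Definition bsign (b : bool) : R := if b then 1 else -1.

(** A set [A] encodes the signs of all vertices, and means are unnormalised sums over all sets.
    Flipping permutes the sign patterns, so such sums are invariant under it. *)
Definition flip B A : {set V} := [set v | (v \in A) (+) (v \in B)].

Lemma in_flip B A v : (v \in flip B A) = (v \in A) (+) (v \in B).
Proof. by rewrite inE. Qed.

Lemma bsignN b : bsign (~~ b) = - bsign b.
Proof. by case: b; rewrite /bsign ?opprK. Qed.

Lemma bsign_sqr b : bsign b ^+ 2 = 1.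
Proof. by case: b; rewrite /bsign ?sqrrN expr1n. Qed.

Lemma bsignM_le1 b c : bsign b * bsign c <= 1.
Proof. by case: b; case: c; rewrite /bsign; lra. Qed.

Lemma flipK B : involutive (flip B).
Proof. by move=> A; apply/setP=> v; rewrite !in_flip -addbA addbb addbF. Qed.

Lemma sum_flip B f : \sum_A f (flip B A) = \sum_A f A.
Proof. by rewrite [RHS](reindex_inj (inv_inj (flipK B))). Qed.

Lemma sum_odd B f : (forall A, f (flip B A) = - f A) -> \sum_A f A = 0.
Proof.
move=> fN; have := sum_flip B f.
rewrite (eq_bigr (fun A => - f A)) => [|A _]; last exact: fN.
rewrite sumrN; lra.
Qed.

Lemma sum_subset_setU1 a D f : a \notin D ->
  \sum_(A : {set V} | A \subset a |: D) f A =
  \sum_(A : {set V} | A \subset D) (f A + f (a |: A)).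
Proof.
move=> aD; rewrite big_split (bigID (fun A => a \in A)) /= addrC; congr (_ + _).
  apply: eq_bigl => A; rewrite -[in RHS](setU1K aD) subsetD1.
  by [].
rewrite (reindex_onto (fun A => a |: A) (fun A => A :\ a)) /=; last first.
  by move=> A /andP[_ aA]; rewrite setD1K.
apply: eq_bigl => A; rewrite setU11 andbT.
have [aA|aA] := boolP (a \in A).
  rewrite (_ : (A \subset D) = false); last first.
    by apply: contraNF aD => /subsetP/(_ _ aA).
  apply/andP=> -[_ /eqP/setP/(_ a)]; by rewrite !inE eqxx aA.
rewrite setU1K // eqxx andbT subUset sub1set setU11 /=.
by rewrite -[in RHS](setU1K aD) subsetD1 aA andbT.
Qed.

Definition increasing f := forall A B, A \subset B -> f A <= f B.

(* Summing out one coordinate [a] reduces to the pointwise Chebyshev inequality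
   [(f0 + f1) (g0 + g1) <= 2 (f0 g0 + f1 g1)]. *)
Lemma harris_subset D f g : increasing f -> increasing g ->
  (\sum_(A : {set V} | A \subset D) f A) *
  (\sum_(A : {set V} | A \subset D) g A) <=
  (2 ^ #|D|)%:R * \sum_(A : {set V} | A \subset D) f A * g A.
Proof.
have [n] := ubnP #|D|; elim: n D f g => // n IHn D f g Dn f_inc g_inc.
have [->|[a aD]] := set_0Vmem D.
  have E h : \sum_(A : {set V} | A \subset set0) h A = h set0 :> R.
    by rewrite (eq_bigl (pred1 set0)) ?big_pred1_eq // => A; rewrite subset0.
  by rewrite !E cards0 expn0 mul1r.
have aD' : a \notin D :\ a by rewrite !inE eqxx.
have Dn' : (#|D :\ a| < n)%N by move: Dn; rewrite (cardsD1 a) aD.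
rewrite -(setD1K aD) !sum_subset_setU1 // cardsU1 aD' expnS natrM.
have inc h : increasing h -> increasing (fun A => h A + h (a |: A)).
  by move=> hinc A B AB; apply: lerD; apply: hinc => //; apply: setUS.
apply: le_trans (IHn _ _ _ Dn' (inc _ f_inc) (inc _ g_inc)) _.
rewrite [2%:R * _]mulrC -mulrA ler_wpM2l ?ler0n //.
rewrite mulr_sumr ler_sum // => A _.
have Aa : A \subset a |: A by apply: subsetUr.
have := f_inc _ _ Aa; have := g_inc _ _ Aa; nra.
Qed.

Lemma harris f g : increasing f -> increasing g -> \sum_A f A = 0 ->
  0 <= \sum_A f A * g A.
Proof.
move=> fi gi f0; have := harris_subset setT fi gi.
have E h : \sum_(A : {set V} | A \subset setT) h A = \sum_A h A :> R.
  by apply: eq_bigl => A; rewrite subsetT.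
by rewrite !E f0 mul0r pmulr_rge0 // ltr0n expn_gt0.
Qed.

(** Averaging the summand with its flip at [u] replaces the first coin by its mean; [u != v] leaves
    the second coin untouched, and [v] is then treated likewise. *)
Lemma sum_coins (u v : V) (p q r s : R) : u != v ->
  \sum_(A : {set V})
     (if u \in A then p else q) * (if v \in A then r else s) =
  #|{set V}|%:R * ((p + q) / 2 * ((r + s) / 2)).
Proof.
move=> uv.
have key w h : \sum_A h A = \sum_A (h A + h (flip [set w] A)) / 2 :> R.
  by rewrite -mulr_suml big_split /= sum_flip; field.
rewrite (key u) (eq_bigr (fun A => (p + q) / 2 * (if v \in A then r else s))).
  rewrite (key v) (eq_bigr (fun A => (p + q) / 2 * ((r + s) / 2))).
    by rewrite sum_set_const.
  by move=> A _; rewrite in_flip inE eqxx addbT; case: (v \in A) => /=; field.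
move=> A _; rewrite !in_flip !inE eqxx addbT (eq_sym v) (negbTE uv) addbF.
by case: (u \in A) => /=; field.
Qed.

Definition sign_sum (D : {set V}) (A : {set V}) : R :=
  \sum_(v in D) bsign (v \in A).

Lemma sign_sum_increasing D : increasing (sign_sum D).
Proof.
move=> A B /subsetP AB; apply: ler_sum => v _.
by have := AB v; case: (v \in A); case: (v \in B); rewrite /bsign // => H;
  lra || by have := H isT.
Qed.

Lemma sign_sum_flip D B A :
  (forall v, v \in D -> v \in B) -> sign_sum D (flip B A) = - sign_sum D A.
Proof.
move=> DB; rewrite -sumrN; apply: eq_bigr => v /DB vB.
by rewrite in_flip vB addbT bsignN.
Qed.

Lemma sign_sum_flip_id D B A :
  (forall v, v \in D -> v \notin B) -> sign_sum D (flip B A) = sign_sum D A.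
Proof.
move=> DB; apply: eq_bigr => v /DB vB.
by rewrite in_flip (negbTE vB) addbF.
Qed.

(** Induction on [D]: odd powers of the sign of the removed vertex average to zero, so the mean
    fourth power grows by 1 + 6k, at most 3(k+1)^2 - 3k^2. *)
Lemma sign_sum_moments D :
  \sum_A sign_sum D A ^+ 2 = #|{set V}|%:R * #|D|%:R /\
  \sum_A sign_sum D A ^+ 4 <= #|{set V}|%:R * (3 * #|D|%:R ^+ 2).
Proof.
have [n] := ubnP #|D|; elim: n D => // n IHn D Dn.
have [->|[a aD]] := set_0Vmem D.
  by split; rewrite big1 ?cards0 ?mulr0 ?expr0n ?mulr0 // => A _;
    rewrite /sign_sum big_set0 expr0n.
have aD' : a \notin D :\ a by rewrite !inE eqxx.
have Dn' : (#|D :\ a| < n)%N by move: Dn; rewrite (cardsD1 a) aD.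
have [IH2 IH4] := IHn _ Dn'; move: IH2 IH4.
rewrite (cardsD1 a D) aD natrD.
set S := sign_sum (D :\ a); set N := #|{set V}|%:R; set k := #|D :\ a|%:R.
move=> IH2 IH4.
have SD A : sign_sum D A = bsign (a \in A) + S A.
  by rewrite /sign_sum (big_setD1 a).
have N1 : \sum_(A : {set V}) 1 = N :> R by rewrite sum_set_const mulr1.
have odd1 j : \sum_(A : {set V}) bsign (a \in A) * S A ^+ j = 0.
  apply: (@sum_odd [set a]) => A.
  rewrite in_flip set11 addbT bsignN mulNr; congr (- (_ * _ ^+ _)).
  by apply: sign_sum_flip_id => v; rewrite !inE => /andP[].
split.
  have -> : \sum_A sign_sum D A ^+ 2 =
      \sum_(A : {set V}) 1 + \sum_A S A ^+ 2 +
      2 * (\sum_(A : {set V}) bsign (a \in A) * S A ^+ 1).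
    rewrite mulr_sumr -!big_split /=; apply: eq_bigr => A _.
    by rewrite SD sqrrD bsign_sqr expr1; ring.
  by rewrite odd1 N1 IH2 mulr1n; ring.
have -> : \sum_A sign_sum D A ^+ 4 =
    \sum_(A : {set V}) 1 + \sum_A S A ^+ 4 + 6 * (\sum_A S A ^+ 2) +
      4 * (\sum_(A : {set V}) bsign (a \in A) * S A ^+ 1) +
      4 * (\sum_(A : {set V}) bsign (a \in A) * S A ^+ 3).
  rewrite !mulr_sumr -!big_split /=; apply: eq_bigr => A _.
  by rewrite SD; case: (a \in A); rewrite /bsign; ring.
rewrite !odd1 N1 IH2 mulr1n.
have N0 : 0 <= N by rewrite ler0n.
nra.
Qed.

(* The quartic bound is tangent to [|s|] at [|s| = 2 sqrt d]; with the moments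
   [E s^2 = d] and [E s^4 <= 3 d^2] it yields the factor 3/4 - 3/16 = 9/16. *)
Lemma khinchine D :
  #|{set V}|%:R * (9 / 16 * Num.sqrt (#|D|%:R : R)) <=
  \sum_A `|sign_sum D A|.
Proof.
have [D0|D0] := posnP #|D|.
  by rewrite D0 sqrtr0 !mulr0 sumr_ge0.
set d : R := #|D|%:R; set r := Num.sqrt d.
have d0 : 0 < d by rewrite ltr0n.
have r0 : 0 < r by rewrite sqrtr_gt0.
have rr : r ^+ 2 = d by rewrite sqr_sqrtr // ltW.
have [M2 M4] := sign_sum_moments D.
have pt A : 3 / 4 / r * sign_sum D A ^+ 2
    - (16 * r ^+ 3)^-1 * sign_sum D A ^+ 4 <= `|sign_sum D A|.
  set s := sign_sum D A.
  have -> : s ^+ 2 = `|s| ^+ 2 by rewrite real_normK ?num_real.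
  have -> : s ^+ 4 = `|s| ^+ 4.
    by rewrite (exprM s 2 2) (exprM `|s| 2 2) real_normK ?num_real.
  move: `|s| (normr_ge0 s) => t t0.
  rewrite -subr_ge0.
  have -> : t - (3 / 4 / r * t ^+ 2 - (16 * r ^+ 3)^-1 * t ^+ 4) =
     t * (t - 2 * r) ^+ 2 * (t + 4 * r) / (16 * r ^+ 3).
    by field; rewrite gt_eqF.
  apply: divr_ge0; last by rewrite mulr_ge0 // exprn_ge0 // ltW.
  by rewrite mulr_ge0 ?(mulr_ge0 t0) ?sqr_ge0 //; lra.
apply: le_trans (ler_sum _ (fun A _ => pt A)).
rewrite sumrB -!mulr_sumr M2.
have c0 : 0 <= (16 * r ^+ 3)^-1.
  by rewrite invr_ge0 mulr_ge0 // exprn_ge0 // ltW.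
apply: le_trans (lerB (lexx _) (ler_wpM2l c0 M4)).
rewrite -/d -rr le_eqVlt; apply/orP; left; apply/eqP.
by field; rewrite gt_eqF.
Qed.

End Signs.

(** * From a power-law tail to the total excess of degrees over a threshold *)

Section Tail.
Variable R : realType.

(* Compares a term of the tail sum with the integral of [t^(-s-1)]. *)
Lemma powR_secant (s a b : R) : 0 < s -> 0 < a -> 0 < b ->
  (b - a) * b `^ (- s - 1) <= (a `^ (- s) - b `^ (- s)) / s.
Proof.
move=> s0 a0 b0.
have b1 : b `^ (- s - 1) = b `^ (- s) / b.
  by rewrite powRD ?(gt_eqF b0) ?implybT // powR_inv1 // ltW.
set c := a / b; have c0 : 0 < c by rewrite divr_gt0.
have -> : a `^ (- s) = b `^ (- s) * c `^ (- s).
  rewrite -powRM ?ltW //; congr (_ `^ _); rewrite /c.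
  by field; rewrite gt_eqF.
(* Bernoulli's inequality, from exp(y) >= 1 + y and ln c <= c - 1. *)
have B : 1 + s * (1 - c) <= c `^ (- s).
  rewrite /powR (gt_eqF c0).
  apply: le_trans (expR_ge1Dx _).
  have : ln c <= c - 1.
    by have := @le_ln1Dx R (c - 1); rewrite subrKC; apply; lra.
  by nra.
rewrite b1 ler_pdivlMr // -subr_ge0.
have -> : b `^ (- s) * c `^ (- s) - b `^ (- s)
    - (b - a) * (b `^ (- s) / b) * s =
    b `^ (- s) * (c `^ (- s) - (1 + s * (1 - c))).
  by rewrite /c; field; rewrite gt_eqF.
by rewrite mulr_ge0 ?powR_ge0 // subr_ge0.
Qed.

(** The increments of [Num.max x k] vanish while [k.+1 <= x]; from there on the secant bound
    telescopes. The maximum also handles the step that crosses a non-integer [x]. *)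
Lemma powR_tail_sum (s x : R) (M : nat) : 0 < s -> 0 < x ->
  \sum_(k < M) (Num.max x k.+1%:R - Num.max x k%:R) * k.+1%:R `^ (- s - 1)
  <= x `^ (- s) / s.
Proof.
move=> s0 x0; set a := fun k : nat => Num.max x k%:R.
have a0 k : 0 < a k by rewrite lt_max x0.
apply: (@le_trans _ _ (\sum_(k < M) (a k `^ (- s) - a k.+1 `^ (- s)) / s)).
  apply: ler_sum => k _.
  have [xk|kx] := leP x k.+1%:R.
    have E : a k.+1 = k.+1%:R by apply/max_idPr.
    by rewrite -/(a k) E powR_secant // ltr0Sn.
  have E1 : a k.+1 = x by apply/max_idPl/ltW.
  have E2 : a k = x.
    by apply/max_idPl/ltW; apply: le_lt_trans kx; rewrite ler_nat.
  by rewrite -/(a k) E1 E2 !subrr !mul0r.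
rewrite -mulr_suml ler_wpM2r ?invr_ge0 ?(ltW s0) //.
rewrite -(big_mkord predT (fun k => a k `^ (- s) - a k.+1 `^ (- s))).
have -> : \sum_(0 <= k < M) (a k `^ (- s) - a k.+1 `^ (- s)) =
   a 0%N `^ (- s) - a M `^ (- s).
  elim: M => [|M IH]; first by rewrite big_geq // subrr.
  by rewrite big_nat_recr //= IH addrA subrK.
have -> : a 0%N = x by apply/max_idPl/ltW.
by rewrite gerBl powR_ge0.
Qed.

(** Layer-cake formula; the cutoff [M], common to all vertices, allows the exchange of sums in
    [total_excess]. *)
Lemma excess_sum (x : R) (d M : nat) : 0 < x -> (d <= M)%N ->
  Num.max x d%:R - x =
  \sum_(k < M) (k < d)%N%:R * (Num.max x k.+1%:R - Num.max x k%:R).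
Proof.
move=> x0 dM; set a := fun k : nat => Num.max x k%:R.
have -> : x = a 0%N by symmetry; apply/max_idPl/ltW.
rewrite -/(a 0%N); have -> : Num.max (a 0%N) d%:R = a d.
  by rewrite /a (max_idPl (ltW x0)).
transitivity (\sum_(0 <= k < d) (a k.+1 - a k));
  first by rewrite telescope_sumr.
rewrite big_mkord (big_ord_widen _ (fun k => a k.+1 - a k) dM) big_mkcond /=.
apply: eq_bigr => k _.
have -> : Num.max (a 0%N) k.+1%:R = a k.+1 by rewrite /a (max_idPl (ltW x0)).
have -> : Num.max (a 0%N) k%:R = a k by rewrite /a (max_idPl (ltW x0)).
by case: ifP; rewrite ?mul1r ?mul0r.
Qed.

Lemma total_excess (V : finType) (d : V -> nat) (K s x : R) :
  0 < s -> 0 < x -> 0 <= K ->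
  (forall k : nat, (1 <= k)%N ->
     #|[set v : V | (k <= d v)%N]|%:R <= K * k%:R `^ (- s - 1)) ->
  \sum_v (Num.max x (d v)%:R - x) <= K * (x `^ (- s) / s).
Proof.
move=> s0 x0 K0 tail; set M := \max_v d v.
have dM v : (d v <= M)%N by apply: leq_bigmax.
rewrite (eq_bigr _ (fun v _ => excess_sum x0 (dM v))) exchange_big /=.
apply: le_trans (ler_wpM2l K0 (powR_tail_sum M s0 x0)).
rewrite mulr_sumr ler_sum // => k _; rewrite -mulr_suml -natr_sum.
have w0 : 0 <= Num.max x k.+1%:R - Num.max x k%:R.
  rewrite subr_ge0 ge_max !le_max lexx /=; apply/orP; right.
  by rewrite ler_nat.
rewrite mulrCA (mulrC (_%:R : R)) ler_wpM2l //.
apply: le_trans (tail k.+1 isT);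
  rewrite ler_nat -sum1dep_card [leqRHS]big_mkcond /=.
by apply: leq_sum => v _; case: ltnP.
Qed.

End Tail.

(** * Modularity of a bisection in terms of signs *)

Section Graph.
Variables (R : realType) (V : finType) (adj : rel V).
Hypotheses (adj_sym : symmetric adj) (adj_irr : irreflexive adj).
Implicit Types (S A B C : {set V}) (u v w : V).

Local Notation sg := (bsign R).
Local Notation d v := ((degree adj v)%:R : R).
Local Notation W := (\sum_(v : V) d v).
Local Notation N := (#|{set V}|%:R : R).

(** Ordered adjacent pairs map two-to-one onto edges: irreflexivity makes the two orientations
    distinct, symmetry makes both occur. *)
Lemma edges_within_double S :
  (2 * edges_within adj S = \sum_(u in S) \sum_(v in S) adj u v)%N.
Proof.
pose P := [set p : V * V | [&& p.1 \in S, p.2 \in S & adj p.1 p.2]].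
have -> : (\sum_(u in S) \sum_(v in S) adj u v = \sum_(p in P) 1)%N.
  rewrite pair_big /= [RHS]big_mkcond [LHS]big_mkcond /=.
  by apply: eq_bigr => -[u v] _; rewrite inE /=;
    case: (u \in S); case: (v \in S); case: (adj u v).
pose F := [set f in edge_set adj | f \subset S].
rewrite (partition_big (fun p => [set p.1; p.2]) (mem F)) /=; last first.
  move=> [u v]; rewrite !inE /= => /and3P[uS vS uv].
  rewrite subUset !sub1set uS vS !andbT.
  by apply/imset2P; exists u v; rewrite ?inE.
rewrite (eq_bigr (fun=> 2%N)) => [|f].
  by rewrite sum_nat_const mulnC.
rewrite inE => /andP[/imset2P[x y _ ] ]; rewrite inE => /andP[_ xy] -> sS.
move: sS; rewrite subUset !sub1set => /andP[xS yS].
have nxy : x != y by apply: contraTneq xy => ->; rewrite adj_irr.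
rewrite sum1dep_card (_ : [set _ | _] = [set (x, y); (y, x)]) ?cards2.
  by rewrite xpair_eqE (negbTE nxy).
apply/setP=> -[u v]; rewrite !inE /= !xpair_eqE; apply/idP/idP.
  case/andP=> /and3P[_ _ uv] /eqP E.
  have nuv : u != v by apply: contraTneq uv => ->; rewrite adj_irr.
  have : u \in [set x; y] by rewrite -E set21.
  have : v \in [set x; y] by rewrite -E set22.
  by rewrite !inE => /orP[]/eqP Ev /orP[]/eqP Eu; move: nuv;
    rewrite Ev Eu !eqxx ?orbT.
by case/orP=> /andP[/eqP-> /eqP->];
  rewrite ?xS ?yS ?xy ?(adj_sym y) ?xy //= ?eqxx // setUC.
Qed.

Lemma edges_within0 : edges_within adj set0 = 0%N.
Proof.
have /eqP := edges_within_double set0.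
by rewrite [X in _ == X]big_set0 muln_eq0 /= => /eqP.
Qed.

Lemma sum_adj u : (\sum_v adj u v = degree adj u)%N.
Proof.
by rewrite /degree -sum1dep_card [RHS]big_mkcond; apply: eq_bigr => v _;
  case: adj.
Qed.

Lemma edge_set_double : 2 * #|edge_set adj|%:R = W :> R.
Proof.
rewrite -natr_sum -(natrM _ 2); congr (_%:R).
rewrite (_ : #|_| = edges_within adj setT).
  rewrite edges_within_double [LHS]big_mkcond /=; apply: eq_bigr => u _.
  by rewrite inE -sum_adj; apply: eq_bigl => v; rewrite inE.
by apply: eq_card => f; rewrite inE subsetT andbT.
Qed.

(** Twice the number of uncut edges minus twice the number of cut ones. *)
Definition cut_form S : R :=
  \sum_u \sum_v (adj u v)%:R * (sg (u \in S) * sg (v \in S)).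

(** The volume of [S] minus that of its complement. *)
Definition imbalance S : R := \sum_v d v * sg (v \in S).

Lemma edges_bisection S :
  (edges_within adj S)%:R + (edges_within adj (~: S))%:R =
  (W + cut_form S) / 4 :> R.
Proof.
have dbl (T : {set V}) : (edges_within adj T)%:R =
    (\sum_u \sum_v (adj u v)%:R * ((u \in T) && (v \in T))%:R) / 2 :> R.
  apply: (mulIf (_ : 2 != 0 :> R)); first by rewrite pnatr_eq0.
  rewrite divfK ?pnatr_eq0 // -natrM mulnC edges_within_double natr_sum
    big_mkcond.
  apply: eq_bigr => u _; case: (u \in T) => /=; last by rewrite big1 // => v;
    rewrite mulr0.
  rewrite natr_sum big_mkcond; apply: eq_bigr => v _.
  by case: (v \in T); rewrite ?mulr1 ?mulr0.
rewrite !dbl -mulrDl -big_split /=.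
have -> : W = \sum_u \sum_v (adj u v)%:R.
  by apply: eq_bigr => u _; rewrite -sum_adj natr_sum.
rewrite /cut_form -big_split /= !mulr_suml; apply: eq_bigr => u _.
rewrite -!big_split /= !mulr_suml; apply: eq_bigr => v _.
by rewrite !inE; case: (u \in S); case: (v \in S); rewrite /bsign /=; field.
Qed.

Lemma vol_sign S : (vol adj S)%:R = (W + imbalance S) / 2.
Proof.
rewrite /vol natr_sum big_mkcond /= -big_split mulr_suml.
by apply: eq_bigr => v _; case: (v \in S); rewrite /bsign /=; field.
Qed.

Lemma imbalanceC S : imbalance (~: S) = - imbalance S.
Proof.
by rewrite -sumrN; apply: eq_bigr => v _; rewrite inE bsignN mulrN.
Qed.

(** With [I] the imbalance, the volumes are (W + I)/2 and (W - I)/2, so the squared terms add up to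
    1/2 + I^2/(2 W^2); this 1/2 cancels the [W] term of [edges_bisection]. *)
Lemma modularity_ge_bisection S : 0 < W ->
  cut_form S / (2 * W) - imbalance S ^+ 2 / (2 * W ^+ 2) <= modularity R adj.
Proof.
move=> W0.
have [x _] : exists x : V, true.
  have [/card0_eq V0|/card_gt0P[x _]] := posnP #|V|; last by exists x.
  by move: W0; rewrite big1 ?ltxx // => x; have := V0 x; rewrite inE.
pose P := [set S; ~: S].
(* [S] may be empty or everything; the empty block is then discarded, at no cost since its score is
   zero. *)
have PP : partition (P :\ set0) [set: V].
  apply/and3P; split; last by rewrite !inE eqxx.
    apply/eqP/setP=> v; rewrite inE; apply/bigcupP.
    have [vS|vS] := boolP (v \in S).
      by exists S; rewrite // !inE eqxx andbT; apply/set0Pn; exists v.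
    exists (~: S); rewrite ?inE ?eqxx ?orbT ?andbT //.
    by apply/set0Pn; exists v; rewrite inE.
  apply/trivIsetP=> X Y;
    rewrite !inE => /andP[_ /orP[]/eqP->] /andP[_ /orP[]/eqP->];
    rewrite ?eqxx // => _.
    by rewrite -setI_eq0 setICr.
  by rewrite -setI_eq0 setIC setICr.
apply: le_trans (modularity_upper_bound R adj PP).
set m : R := #|edge_set adj|%:R.
have Wm : W = 2 * m by rewrite edge_set_double.
have m0 : 0 < m by move: W0; rewrite Wm pmulr_rgt0.
rewrite /modularity_score -/m.
pose f (T : {set V}) : R :=
  (edges_within adj T)%:R / m - ((vol adj T)%:R / (2 * m)) ^+ 2.
rewrite -[leRHS]/(\sum_(T in P :\ set0) f T).
have f0 : f set0 = 0.
  by rewrite /f edges_within0 /vol big_set0 mul0r mul0r expr0n subrr.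
have -> : \sum_(T in P :\ set0) f T = f S + f (~: S).
  transitivity (\sum_(T in P) f T).
    have [P0|P0] := boolP (set0 \in P);
      first by rewrite [RHS](big_setD1 set0) //= f0 add0r.
    by apply: eq_bigl => T; rewrite !inE; case: eqP => // ->; move: P0;
      rewrite !inE => /negbTE ->.
  rewrite big_setU1 ?big_set1 // inE; apply/eqP=> /setP/(_ x).
  by rewrite inE; case: (x \in S).
rewrite /f !vol_sign imbalanceC addrACA -mulrDl edges_bisection Wm.
rewrite le_eqVlt; apply/orP; left; apply/eqP.
by field; rewrite gt_eqF.
Qed.

(* The vertices in the first argument [B] of [recut] of degree at most [D] move
   to the side holding the majority of their neighbours, all of them at once and
   with respect to the initial side [A]; ties are not moved. *)
Variable D : R.
Hypothesis D_ge0 : 0 <= D.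

(** * The random majority recut: oddness, monotonicity and mean of the cut form *)

Definition nbrs v : {set V} := [set w | adj v w].

Definition low v := d v <= D.

Definition bias v A : R := sign_sum R (nbrs v) A.

Definition majority v A : bool :=
  if low v && (bias v A != 0) then 0 < bias v A else v \in A.

(** A low [v] belongs to its own set because a tie leaves it on its initial side. *)
Definition dependency v : {set V} := if low v then v |: nbrs v else [set v].

Definition recut B A : {set V} :=
  [set v | if v \in B then majority v A else v \in A].

Lemma mem_dependency v : v \in dependency v.
Proof. by rewrite /dependency; case: ifP; rewrite !inE eqxx. Qed.

Lemma nbrs_dependency v w : low v -> w \in nbrs v -> w \in dependency v.
Proof. by rewrite /dependency => -> wv; rewrite inE wv orbT. Qed.

Lemma majority_flip v B A : dependency v \subset B ->
  majority v (flip B A) = ~~ majority v A.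
Proof.
move=> /subsetP vB; rewrite /majority in_flip (vB _ (mem_dependency v)) addbT.
case Lv: (low v) => //=.
have -> : bias v (flip B A) = - bias v A.
  by apply: sign_sum_flip => w wv; apply/vB/nbrs_dependency.
by rewrite oppr_eq0 oppr_gt0; case: (ltrgt0P (bias v A)).
Qed.

Lemma majority_flip_id v B A : [disjoint dependency v & B] ->
  majority v (flip B A) = majority v A.
Proof.
move=> vB; have nB w : w \in dependency v -> w \notin B.
  by move=> /(disjointFr vB) ->.
rewrite /majority in_flip (negbTE (nB _ (mem_dependency v))) addbF.
case Lv: (low v) => //=.
by rewrite /bias sign_sum_flip_id // => w wv; apply/nB/nbrs_dependency.
Qed.

Lemma recut_flip v B C A : dependency v \subset C ->
  (v \in recut B (flip C A)) = (v \notin recut B A).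
Proof.
move=> vC; rewrite !inE majority_flip // addbC.
by rewrite (subsetP vC _ (mem_dependency v)); case: (v \in B).
Qed.

Lemma recut_flip_id v B C A : [disjoint dependency v & C] ->
  (v \in recut B (flip C A)) = (v \in recut B A).
Proof.
move=> vC; rewrite !inE majority_flip_id //.
by rewrite (disjointFr vC (mem_dependency v)) addbF.
Qed.

Lemma bsign_le (b c : bool) : (b -> c) -> sg b <= sg c.
Proof.
by case: b; case: c => // H; rewrite /bsign; (lra || by have := H isT).
Qed.

Lemma bsign_mem_increasing v : increasing (fun A => sg (v \in A)).
Proof. by move=> A B /subsetP AB; apply/bsign_le/AB. Qed.

(** Enlarging the side can only raise the bias. At bias zero the vertex keeps its own sign, itself
    increasing, so the tie rule preserves monotonicity. *)
Lemma majority_increasing v : increasing (fun A => sg (majority v A)).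
Proof.
move=> A B AB; apply: bsign_le; rewrite /majority.
have := sign_sum_increasing R (nbrs v) AB; rewrite -/(bias v A) -/(bias v B).
move/subsetP/(_ v): AB; case: (low v) => //= AB le_bias.
case: (ltrgt0P (bias v A)) le_bias => [sA|sA|->] le_bias //.
  by rewrite gt_eqF ?(lt_le_trans sA).
by move=> /AB vB; case: ltrgt0P le_bias.
Qed.

Lemma sum_majority v : \sum_A sg (majority v A) = 0.
Proof.
by apply: (@sum_odd _ _ (dependency v)) => A; rewrite majority_flip // bsignN.
Qed.

Lemma sum_bsign_mem v : \sum_(A : {set V}) sg (v \in A) = 0.
Proof.
by apply: (@sum_odd _ _ [set v]) => A; rewrite in_flip set11 addbT bsignN.
Qed.

(** For low [v] the majority sign times the bias is the absolute bias, also at ties, and [khinchine]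
    applies; otherwise Harris gives nonnegativity. *)
Lemma sum_majority_bias v :
  (if low v then N * (9 / 16 * Num.sqrt (d v)) else 0) <=
  \sum_A sg (majority v A) * bias v A.
Proof.
case Lv: (low v); last first.
  by apply: harris (sum_majority v);
    [exact: majority_increasing | exact: sign_sum_increasing].
apply: le_trans (khinchine R (nbrs v)) _.
apply: ler_sum => A _; rewrite /majority Lv /= -/(bias v A).
case: (ltrgt0P (bias v A)) => H /=; rewrite /bsign.
- by rewrite mul1r.
- by rewrite mulN1r.
- by rewrite H mulr0.
Qed.

(** Averaging over the coins [B] leaves, for each edge, a quarter of the sum of four products of
    initial and majority signs. The gain is in the two mixed ones: summed over neighbours they give
    majority times bias, whence 2/4 of 9/16, which is 9/32. *)
Lemma recut_form_mean :
  N ^+ 2 * (9 / 32 * \sum_(v | low v) Num.sqrt (d v)) <=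
  \sum_B \sum_A cut_form (recut B A).
Proof.
pose x v A := sg (v \in A); pose t v A := sg (majority v A).
have pair u v : u != v ->
    N * ((\sum_A t u A * x v A + \sum_A x u A * t v A) / 4) <=
    \sum_A \sum_B sg (u \in recut B A) * sg (v \in recut B A).
  move=> uv.
  have -> : \sum_A \sum_B sg (u \in recut B A) * sg (v \in recut B A) =
      N * ((\sum_A t u A * t v A + \sum_A t u A * x v A +
            \sum_A x u A * t v A + \sum_A x u A * x v A) / 4).
    rewrite -!big_split /= mulr_suml mulr_sumr; apply: eq_bigr => A _.
    transitivity (\sum_(B : {set V}) (if u \in B then t u A else x u A) *
        (if v \in B then t v A else x v A)).
      by apply: eq_bigr => B _; rewrite !inE /t /x; case: (u \in B);
        case: (v \in B).
    by rewrite sum_coins //; congr (_ * _); field.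
  rewrite ler_wpM2l ?ler0n // ler_pM2r ?invr_gt0 ?ltr0n //.
  have tt : 0 <= \sum_A t u A * t v A.
    by apply: harris (sum_majority u); apply: majority_increasing.
  have xx : 0 <= \sum_A x u A * x v A.
    by apply: harris (sum_bsign_mem u); apply: bsign_mem_increasing.
  by move: tt xx; set p := \sum_A _; set q := \sum_A _; lra.
have biasE v A : bias v A = \sum_w (adj v w)%:R * x w A.
  rewrite /bias /sign_sum big_mkcond; apply: eq_bigr => w _.
  by rewrite inE; case: adj; rewrite ?mul1r ?mul0r.
have -> : \sum_B \sum_A cut_form (recut B A) = \sum_u \sum_v (adj u v)%:R *
    \sum_A \sum_B sg (u \in recut B A) * sg (v \in recut B A).
  under eq_bigr => B _ do rewrite exchange_big /=.
  rewrite exchange_big; apply: eq_bigr => u _ /=.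
  under eq_bigr => B _ do rewrite exchange_big /=.
  rewrite exchange_big; apply: eq_bigr => v _ /=.
  by rewrite exchange_big mulr_sumr; apply: eq_bigr => A _; rewrite mulr_sumr.
apply: (@le_trans _ _ (\sum_u \sum_v (adj u v)%:R *
    (N * ((\sum_A t u A * x v A + \sum_A x u A * t v A) / 4)))); last first.
  apply: ler_sum => u _; apply: ler_sum => v _.
  case uv: (adj u v); last by rewrite !mul0r.
  by rewrite !mul1r pair //; apply: contraTneq uv => ->; rewrite adj_irr.
have -> : \sum_u \sum_v (adj u v)%:R *
    (N * ((\sum_A t u A * x v A + \sum_A x u A * t v A) / 4)) =
    N / 2 * \sum_u \sum_A t u A * bias u A.
  transitivity (N / 4 * (\sum_u \sum_v (adj u v)%:R * \sum_A t u A * x v A) +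
      N / 4 * (\sum_u \sum_v (adj u v)%:R * \sum_A x u A * t v A)).
    rewrite !mulr_sumr -big_split; apply: eq_bigr => u _ /=.
    rewrite !mulr_sumr -big_split; apply: eq_bigr => v _ /=.
    by set p := \sum_A _; set q := \sum_A _; field.
  have E1 : \sum_u \sum_v (adj u v)%:R * (\sum_A t u A * x v A) =
      \sum_u \sum_A t u A * bias u A.
    apply: eq_bigr => u _; under [RHS]eq_bigr => A _ do rewrite biasE mulr_sumr.
    rewrite exchange_big; apply: eq_bigr => v _ /=; rewrite mulr_sumr.
    by apply: eq_bigr => A _; rewrite mulrCA.
  have E2 : \sum_u \sum_v (adj u v)%:R * (\sum_A x u A * t v A) =
      \sum_u \sum_A t u A * bias u A.
    rewrite -E1 exchange_big; apply: eq_bigr => u _; apply: eq_bigr => v _.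
    by rewrite adj_sym; congr (_ * _); apply: eq_bigr => A _; rewrite mulrC.
  by rewrite E1 E2; set p := \sum_u _; field.
apply: le_trans (ler_wpM2l _ (ler_sum _ (fun v _ => sum_majority_bias v)));
  last first.
  by rewrite divr_ge0.
rewrite -big_mkcond -!mulr_sumr /=; set p := \sum_(u | _) _.
by rewrite le_eqVlt; apply/orP; left; apply/eqP; field.
Qed.

(** * Second moment of the imbalance, and the averaging argument *)

Lemma dependency_weight w : \sum_(v | w \in dependency v) d v <= (1 + D) * d w.
Proof.
(* [w] counts for itself; any other [v] is a low neighbour of [w], of degree at most [D]. *)
apply: (@le_trans _ _ (\sum_v ((v == w)%:R * d v + (adj w v)%:R * D))).
  rewrite big_mkcond; apply: ler_sum => v _; rewrite /dependency.
  have [Lv|Lv] := boolP (low v); rewrite !inE (eq_sym w) ?(adj_sym v).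
    have [->|_] := eqVneq v w; rewrite ?mul1r ?mul0r /=.
      by rewrite lerDl mulr_ge0.
    by case: adj; rewrite ?mul1r ?mul0r ?add0r.
  by case: eqP => _; rewrite ?mul1r ?mul0r ?lerDl ?addr_ge0 ?mulr_ge0.
rewrite big_split -mulr_suml -natr_sum sum_adj mulrDl mul1r mulrC.
rewrite (bigD1 w) //= eqxx mul1r big1 ?addr0 ?lerD2l 1?mulrC //.
by move=> v /negbTE ->; rewrite mul0r.
Qed.

(** The right-hand sum counts common elements. If there are none, flipping the set of [u] reverses
    the first sign and fixes the second, so the left side vanishes; otherwise the count is at least
    1. *)
Lemma recut_pair_le u v B :
  \sum_A sg (u \in recut B A) * sg (v \in recut B A) <=
  N * \sum_w (w \in dependency u)%:R * (w \in dependency v)%:R.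
Proof.
have [dis|/pred0Pn[w /andP[wv wu]]] := boolP [disjoint dependency v &
  dependency u].
  rewrite (@sum_odd _ _ (dependency u)) => [|A].
    by rewrite mulr_ge0 // sumr_ge0 // => w _; rewrite mulr_ge0.
  by rewrite recut_flip // recut_flip_id // bsignN mulNr.
apply: (@le_trans _ _ N).
  rewrite -[leRHS]mulr1 -sum_set_const; apply: ler_sum => A _;
    exact: bsignM_le1.
rewrite -[leLHS]mulr1 ler_wpM2l // (bigD1 w) //=.
rewrite (wu : w \in dependency u) (wv : w \in dependency v) mulr1 lerDl.
by rewrite sumr_ge0 // => w' _; rewrite mulr_ge0.
Qed.

Lemma recut_imbalance_mean (Delta : R) : (forall v, d v <= Delta) ->
  \sum_B \sum_A imbalance (recut B A) ^+ 2 <=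
  N ^+ 2 * ((1 + D) ^+ 2 * Delta * W).
Proof.
move=> dDelta.
rewrite expr2 -mulrA -(sum_set_const V (N * _)); apply: ler_sum => B _.
have -> : \sum_A imbalance (recut B A) ^+ 2 = \sum_u \sum_v d u * d v *
    \sum_A sg (u \in recut B A) * sg (v \in recut B A).
  transitivity (\sum_A \sum_u \sum_v d u * d v *
      (sg (u \in recut B A) * sg (v \in recut B A))).
    apply: eq_bigr => A _; rewrite expr2 mulr_suml; apply: eq_bigr => u _.
    by rewrite mulr_sumr; apply: eq_bigr => v _; rewrite mulrACA.
  rewrite exchange_big; apply: eq_bigr => u _ /=.
  by rewrite exchange_big; apply: eq_bigr => v _ /=; rewrite mulr_sumr.
apply: (@le_trans _ _ (\sum_u \sum_v d u * d v *
    (N * \sum_w (w \in dependency u)%:R * (w \in dependency v)%:R))).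
  apply: ler_sum => u _; apply: ler_sum => v _.
  by rewrite ler_wpM2l ?mulr_ge0 // recut_pair_le.
(* Double counting over the common elements [w] produces a sum of squares, to which
   [dependency_weight] applies. *)
have -> : \sum_u \sum_v d u * d v *
    (N * \sum_w (w \in dependency u)%:R * (w \in dependency v)%:R) =
    N * \sum_w (\sum_(v | w \in dependency v) d v) ^+ 2.
  transitivity (\sum_u \sum_v \sum_w N * (((w \in dependency u)%:R * d u) *
      ((w \in dependency v)%:R * d v))).
    apply: eq_bigr => u _; apply: eq_bigr => v _; rewrite !mulr_sumr.
    by apply: eq_bigr => w _; ring.
  under eq_bigr => u _ do rewrite exchange_big /=.
  rewrite exchange_big mulr_sumr; apply: eq_bigr => w _ /=.
  have -> : \sum_(v | w \in dependency v) d v = \sum_v (w \in dependency v)%:R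
    * d v.
    by rewrite big_mkcond; apply: eq_bigr => v _; case: (w \in _);
      rewrite ?mul1r ?mul0r.
  rewrite expr2 mulr_suml mulr_sumr; apply: eq_bigr => u _.
  by rewrite !mulr_sumr.
rewrite ler_wpM2l // mulr_sumr; apply: ler_sum => w _.
apply: (@le_trans _ _ (((1 + D) * d w) ^+ 2)).
  by rewrite lerXn2r ?nnegrE ?dependency_weight ?sumr_ge0 ?mulr_ge0 ?addr_ge0.
rewrite exprMn -mulrA ler_wpM2l ?sqr_ge0 // expr2 ler_wpM2r //.
Qed.

(** The modularity dominates the bisection bound of every recut, hence the mean of these bounds over
    all pairs of [B] and [A]. *)
Lemma modularity_ge_recut (Delta : R) : 0 < W -> (forall v, d v <= Delta) ->
  9 / 64 * (\sum_(v | low v) Num.sqrt (d v)) / W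
    - (1 + D) ^+ 2 * Delta / (2 * W) <= modularity R adj.
Proof.
move=> W0 dDelta.
have N0 : 0 < N by rewrite ltr0n; apply/card_gt0P; exists set0.
have lo : \sum_(B : {set V}) \sum_(A : {set V})
    (cut_form (recut B A) / (2 * W) - imbalance (recut B A) ^+ 2 / (2 * W ^+ 2))
    <= N ^+ 2 * modularity R adj.
  rewrite expr2 -mulrA -!sum_set_const; apply: ler_sum => B _;
    apply: ler_sum => A _.
  exact: modularity_ge_bisection.
rewrite -(ler_pM2l (exprn_gt0 2 N0)); apply: le_trans lo.
under [leRHS]eq_bigr => B _ do rewrite sumrB -!mulr_suml.
rewrite sumrB -!mulr_suml.
have i1 : 0 <= (2 * W)^-1 by rewrite invr_ge0 mulr_ge0 // ltW.
have i2 : 0 <= (2 * W ^+ 2)^-1 by rewrite invr_ge0 mulr_ge0 // sqr_ge0.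
apply: le_trans (lerB (ler_wpM2r i1 recut_form_mean) (ler_wpM2r i2
  (recut_imbalance_mean dDelta))).
rewrite le_eqVlt; apply/orP; left; apply/eqP.
move: (gt_eqF W0); set w := W; set p := \sum_(v | _) _ => w0.
by field; rewrite w0.
Qed.

End Graph.

(** * The degree scale [x], the low vertices and the maximal degree *)

Section Scale.
Variable R : realType.

(** This [x] is solved for so that the bound of [total_excess], per vertex, is an eighth of the
    average degree; the 8 in [b] originates here. *)
Lemma scale_tail (s A dbar : R) : 0 < s -> 0 < A -> 0 < dbar ->
  let x := (8 * A / s) `^ (s^-1) * dbar in
  A * dbar `^ (s + 1) * (x `^ (- s) / s) = dbar / 8.
Proof.
move=> s0 A0 d0 x.
have c0 : 0 < 8 * A / s by rewrite divr_gt0 // mulr_gt0.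
have -> : x `^ (- s) = (s / (8 * A)) * dbar `^ (- s).
  rewrite /x powRM ?powR_ge0 ?ltW // -powRrM mulrN mulVf ?gt_eqF //.
  by rewrite powR_inv1 ?ltW // invf_div.
have -> : dbar `^ (s + 1) = dbar `^ s * dbar.
  by rewrite powRD ?(gt_eqF d0) ?implybT // powRr1 // ltW.
rewrite powRN; have := powR_gt0 s d0; move: (dbar `^ s) => p p0.
by field; rewrite !gt_eqF.
Qed.

Lemma scale_target (s A dbar : R) : 0 < s -> 0 < A -> 0 < dbar ->
  let x := (8 * A / s) `^ (s^-1) * dbar in
  (s / (8 * A)) `^ (1 / (2 * s)) * dbar `^ (- (1 / 2)) = (Num.sqrt x)^-1.
Proof.
move=> s0 A0 d0 x.
have c0 : 0 < 8 * A / s by rewrite divr_gt0 // mulr_gt0.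
have x0 : 0 < x by rewrite mulr_gt0 ?powR_gt0.
rewrite -powR12_sqrt ?ltW // -powRN /x [RHS]powRM ?powR_ge0 ?ltW //;
  congr (_ * _).
  rewrite -(invf_div (8 * A)) -[(8 * A / s)^-1]powR_inv1 ?ltW // -!powRrM;
    congr (_ `^ _).
  by field; rewrite gt_eqF.
by congr (_ `^ _); field.
Qed.

Lemma sum_sqrt_low (V : finType) (d : V -> nat) (x W : R) : 0 < x ->
  W = \sum_v (d v)%:R ->
  \sum_v (Num.max x (d v)%:R - x) <= W / 8 ->
  13 / 16 * W / Num.sqrt x <=
  \sum_(v | (d v)%:R <= 16 * x) Num.sqrt ((d v)%:R : R).
Proof.
move=> x0 WE exc.
have r0 : 0 < Num.sqrt x by rewrite sqrtr_gt0.
rewrite ler_pdivrMr // mulr_suml.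
(* Up to 16x the left side is at most min(d, x), hence at most sqrt(d x); above 16x it is x - d/16 <
   0. Summing leaves 15/16 - 1/8 = 13/16. *)
have pt v : (15 / 16 * (d v)%:R - (Num.max x (d v)%:R - x)) <=
    (if (d v)%:R <= 16 * x then Num.sqrt (d v)%:R * Num.sqrt x else 0).
  have [dx|xd] := leP x (d v)%:R.
    case: (leP (d v)%:R (16 * x)) => h; last lra.
    have : x <= Num.sqrt (d v)%:R * Num.sqrt x.
      by rewrite -{1}(sqr_sqrtr (ltW x0)) expr2 ler_pM2r // ler_sqrt // ltW.
    have : 0 <= (d v)%:R :> R by [].
    lra.
  case: (leP (d v)%:R (16 * x)) => h; last lra.
  have : (d v)%:R <= Num.sqrt (d v)%:R * Num.sqrt x.
    rewrite -{1}(sqr_sqrtr (ler0n R (d v))) expr2 ler_wpM2l ?sqrtr_ge0 //.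
    by rewrite ler_sqrt ?ltW.
  have : 0 <= (d v)%:R :> R by [].
  lra.
apply: (@le_trans _ _ (\sum_v (15 / 16 * (d v)%:R - (Num.max x (d v)%:R - x)))).
  rewrite sumrB -mulr_sumr -WE; lra.
by rewrite [leRHS]big_mkcond; apply: ler_sum => v _; apply: pt.
Qed.

(** A single vertex of degree [k] already has tail frequency at least 1/n. If k > eps n, the tail
    bound forces n^(tau - 2) <= K, which fails once n exceeds K^(1/(tau - 2)). *)
Lemma max_degree_sublinear (tau A dbar eps : R) :
  2 < tau -> 0 < A -> 0 < dbar -> 0 < eps ->
  exists n0 : nat, forall n k : nat, (n0 <= n)%N -> (0 < k)%N ->
    n%:R^-1 <= A * dbar `^ (tau - 1) * k%:R `^ (1 - tau) -> k%:R <= eps * n%:R.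
Proof.
move=> t2 A0 d0 e0.
set K := A * dbar `^ (tau - 1) * eps `^ (1 - tau).
have K0 : 0 < K by rewrite !mulr_gt0 ?powR_gt0.
set y := K `^ (tau - 2)^-1; have y0 : 0 < y by apply: powR_gt0.
exists (Num.truncn y).+1 => n k n0 k0 h; rewrite leNgt; apply/negP => kn.
have yn : y < n%:R.
  by apply: lt_le_trans (truncnS_gt y) _; rewrite ler_nat.
have nn0 : 0 < n%:R :> R by apply: lt_trans yn.
have Kn : K < n%:R `^ (tau - 2).
  have -> : K = y `^ (tau - 2).
    by rewrite /y -powRrM mulVf ?powRr1 ?ltW // gt_eqF // subr_gt0.
  by apply: gt0_ltr_powR; rewrite ?nnegrE ?ltW // subr_gt0.
have kk : k%:R `^ (1 - tau) <= eps `^ (1 - tau) * n%:R `^ (1 - tau).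
  rewrite -powRM ?(ltW e0) ?(ltW nn0) // -(opprB tau) !powRN.
  rewrite lef_pV2 ?posrE ?powR_gt0 ?mulr_gt0 ?nn0 ?(ltr0n _ k) //.
  by apply: ge0_ler_powR;
    rewrite ?nnegrE ?mulr_ge0 ?(ltW e0) ?(ltW kn) ?subr_ge0 //; lra.
have : n%:R^-1 <= K * n%:R `^ (1 - tau).
  apply: le_trans h _; rewrite /K -!mulrA !(ler_pM2l A0).
  by apply: ler_wpM2l; [exact: powR_ge0|exact: kk].
have -> : n%:R `^ (1 - tau) = (n%:R `^ (tau - 2))^-1 * n%:R^-1 :> R.
  rewrite (_ : 1 - tau = - (tau - 2) + - 1); last by ring.
  by rewrite [LHS]powRD ?(gt_eqF nn0) ?implybT // powRN powR_inv1 // ltW.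
rewrite mulrA -[leLHS]mul1r ler_pM2r ?invr_gt0 //.
by rewrite ler_pdivlMr ?powR_gt0 // mul1r leNgt Kn.
Qed.

End Scale.

(** * Assembly of the bounds and the numerical constants *)

Theorem theorem1p2 (R : realType) (tau A dbar : R)
    (htau : 2 < tau) (hA : 0 < A) (hdbar : 0 < dbar) :
  let b : R := 1 / 10 * ((tau - 2) / (8 * A)) `^ (1 / (2 * (tau - 2))) in
  exists n0 : nat, forall n : nat, (n0 <= n)%N ->
    forall (V : finType) (adj : rel V),
      simple_graph adj -> #|V| = n -> average_degree R adj = dbar ->
      (forall k : nat, (1 <= k)%N ->
         #|[set v : V | (k <= degree adj v)%N]|%:R / n%:R
           <= A * dbar `^ (tau - 1) * k%:R `^ (1 - tau)) ->
      b * dbar `^ (- (1 / 2)) <= modularity R adj.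
Proof.
move=> b; set s := tau - 2.
have s0 : 0 < s by rewrite subr_gt0.
set x := (8 * A / s) `^ (s^-1) * dbar.
have x0 : 0 < x by rewrite mulr_gt0 ?powR_gt0 // divr_gt0 // mulr_gt0.
set r := Num.sqrt x; have r0 : 0 < r by rewrite sqrtr_gt0.
have q0 : 0 < (1 + 16 * x) ^+ 2 by rewrite exprn_gt0 // addr_gt0 // mulr_gt0.
(* Makes the imbalance error exactly 1/(100 r), as [W] equals [dbar * n%:R]. *)
pose eps := dbar / (50 * r * (1 + 16 * x) ^+ 2).
have e0 : 0 < eps by rewrite divr_gt0 // mulr_gt0 // mulr_gt0.
have [n0 n0P] := max_degree_sublinear htau hA hdbar e0.
exists n0 => n nn0 V adj [adj_sym adj_irr] Vn avg tail.
set W := \sum_(v : V) ((degree adj v)%:R : R).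
(* Division by zero yields 0, so an empty graph would have average degree 0, against [hdbar]. *)
have nR : 0 < n%:R :> R.
  rewrite ltr0n lt0n; apply: contraTneq hdbar => n_eq0.
  by rewrite -avg /average_degree Vn n_eq0 invr0 mulr0 ltxx.
have WE : W = dbar * n%:R.
  by rewrite -avg /average_degree Vn divfK ?gt_eqF // natr_sum.
have W0 : 0 < W by rewrite WE mulr_gt0.
have maxdeg v : (degree adj v)%:R <= eps * n%:R.
  (* The tail hypothesis starts at degree 1, so isolated vertices are set apart; any other [v] is
     itself counted in the tail at its own degree. *)
  have [->|dv] := posnP (degree adj v); first by rewrite mulr_ge0 ?ltW.
  apply: n0P => //; apply: le_trans (tail _ dv).
  rewrite ler_peMl ?invr_ge0 // ler1n; apply/card_gt0P; exists v.
  by rewrite inE.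
have D0 : 0 <= 16 * x by rewrite mulr_ge0 // ltW.
have := modularity_ge_recut adj_sym adj_irr D0 W0 maxdeg.
apply: le_trans.
have exc : \sum_v (Num.max x (degree adj v)%:R - x) <= W / 8.
  apply: le_trans (total_excess (K := n%:R * (A * dbar `^ (s + 1))) s0 x0 _ _)
    _.
  - by rewrite !mulr_ge0 ?powR_ge0 ?ltW.
  - move=> k k1; have := tail k k1; rewrite ler_pdivrMr // mulrC -!mulrA.
    rewrite (_ : s + 1 = tau - 1); last by rewrite /s; ring.
    by rewrite (_ : - s - 1 = 1 - tau); last by rewrite /s; ring.
  - rewrite -mulrA scale_tail // WE; lra.
have lowsum := sum_sqrt_low x0 (erefl W) exc.
rewrite /b -[_ * _ * dbar `^ _]mulrA -/s scale_target // -/x -/r -/W.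
have err : (1 + 16 * x) ^+ 2 * (eps * n%:R) / (2 * W) = (100 * r)^-1.
  by rewrite WE /eps; field; rewrite !gt_eqF // addr_gt0 // mulr_gt0.
rewrite err.
have : 9 / 64 * (13 / 16 * W / r) / W <=
   9 / 64 * (\sum_(v | low adj (16 * x) v) Num.sqrt ((degree adj v)%:R : R)) /
     W.
  by rewrite ler_pM2r ?invr_gt0 // ler_pM2l ?divr_gt0 //; exact: lowsum.
have -> : 9 / 64 * (13 / 16 * W / r) / W = 117 / 1024 * r^-1.
  by field; rewrite !gt_eqF.
rewrite invfM; have : 0 < r^-1 by rewrite invr_gt0.
(* Numerically 117/1024 - 1/100 > 1/10. *)
set p := _ / W; lra.
Qed.
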